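(* Let $L$ be a bounded chain, $n\geqslant 1$, and let $f\colon L^n\to L$ be a function. The following assertions are equivalent: (i) $f$ is horizontally maxitive, horizontally minitive, and satisfies $\mathbf{P_1}$ or $\mathbf{D_1}$. (ii) $f$ is comonotonic maxitive and comonotonic minitive. (iii) $f$ is horizontally maxitive and comonotonic minitive. (iv) $f$ is comonotonic maxitive and horizontally minitive. (v) There exist a polynomial function $p\colon L^n\to L$ and a nondecreasing function $\varphi\colon L\to L$ such that $f(x_1,\ldots,x_n)=p(\varphi(x_1),\ldots,\varphi(x_n))$ for all $(x_1,\ldots,x_n)\in L^n$. If these conditions hold, then in (v) we can choose for $p$ the unique polynomial function $p_f\colon L^n\to L$ extending $f|_{\{0,1\}^n}$, and for $\varphi$ the diagonal section $\delta_f$ of $f$.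
   Context: $L$ is a bounded chain (totally ordered set) with least element $0$, greatest element $1$, and $\wedge=\min$, $\vee=\max$. $[n]=\{1,\ldots,n\}$. $L^n$ carries the componentwise order and operations; for $\mathbf{x}\in L^n$, $c\in L$, $\mathbf{x}\wedge c=(x_1\wedge c,\ldots,x_n\wedge c)$ and $\mathbf{x}\vee c=(x_1\vee c,\ldots,x_n\vee c)$. $\{0,1\}^n\subseteq L^n$ uses the bounds $0,1$ of $L$. Polynomial functions $L^n\to L$ form the smallest class of functions containing all projections $\mathbf{x}\mapsto x_i$ and all constant functions and closed under pointwise $\vee$ and $\wedge$. (Every nondecreasing function $\{0,1\}^n\to L$ extends to a unique polynomial function $L^n\to L$.) The diagonal section of $f$ is $\delta_f(x)=f(x,\ldots,x)$. $f$ is horizontally maxitive if $f(\mathbf{x})=f(\mathbf{x}\wedge c)\vee f([\mathbf{x}]_c)$ for all $\mathbf{x}\in L^n$, $c\in L$, where $[\mathbf{x}]_c$ has $i$th component $0$ if $x_i\leqslant c$, and $x_i$ otherwise. $f$ is horizontally minitive if $f(\mathbf{x})=f(\mathbf{x}\vee c)\wedge f([\mathbf{x}]^c)$ for all $\mathbf{x}\in L^n$, $c\in L$, where $[\mathbf{x}]^c$ has $i$th component $1$ if $x_i\geqslant c$, and $x_i$ otherwise. $\mathbf{P_1}$: $f(\mathbf{e}\wedge c)\leqslant f(\mathbf{e}'\wedge c)$ for all $\mathbf{e}\leqslant\mathbf{e}'$ in $\{0,1\}^n$ and all $c\in L$. $\mathbf{D_1}$: $f(\mathbf{e}\vee c)\leqslant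 f(\mathbf{e}'\vee c)$ for all $\mathbf{e}\leqslant\mathbf{e}'$ in $\{0,1\}^n$ and all $c\in L$. Vectors $\mathbf{x},\mathbf{x}'\in L^n$ are comonotonic if there is a permutation $\sigma$ of $[n]$ such that $x_{\sigma(1)}\leqslant\cdots\leqslant x_{\sigma(n)}$ and $x'_{\sigma(1)}\leqslant\cdots\leqslant x'_{\sigma(n)}$. $f$ is comonotonic maxitive (resp. comonotonic minitive) if $f(\mathbf{x}\vee\mathbf{x}')=f(\mathbf{x})\vee f(\mathbf{x}')$ (resp. $f(\mathbf{x}\wedge\mathbf{x}')=f(\mathbf{x})\wedge f(\mathbf{x}')$) for any two comonotonic $\mathbf{x},\mathbf{x}'\in L^n$. *)

(* Defs.v *)
From mathcomp Require Export all_boot all_order fingroup perm.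

Set Implicit Arguments.
Unset Strict Implicit.
Unset Printing Implicit Defensive.

(* Puts the componentwise order and lattice operations on [n.-tuple L]. *)
Export Order.DefaultTupleProdOrder.

Local Open Scope order_scope.

Section Definitions.

(* On a [tbOrderType], [`&`] and [`|`] are min and max. *)
Context {d : Order.disp_t} {L : tbOrderType d} {n : nat}.
Implicit Types (f p : n.-tuple L -> L) (x e : n.-tuple L) (c : L).

Definition capc x c : n.-tuple L := map_tuple (fun t => t `&` c) x.
Definition cupc x c : n.-tuple L := map_tuple (fun t => t `|` c) x.

Definition cutbot x c : n.-tuple L :=
  map_tuple (fun t => if t <= c then \bot else t) x.
Definition cuttop x c : n.-tuple L :=
  map_tuple (fun t => if c <= t then \top else t) x.

Definition is_boolean x : bool := all [pred t | (t == \bot) || (t == \top)] x.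

(* Membership is intensional: a function that is only pointwise equal to a
   polynomial function need not satisfy it without functional extensionality. *)
Inductive polynomial_fun : (n.-tuple L -> L) -> Prop :=
| Poly_proj i : polynomial_fun (fun x => tnth x i)
| Poly_const c : polynomial_fun (fun=> c)
| Poly_join p q : polynomial_fun p -> polynomial_fun q ->
    polynomial_fun (fun x => p x `|` q x)
| Poly_meet p q : polynomial_fun p -> polynomial_fun q ->
    polynomial_fun (fun x => p x `&` q x).

Definition extends_boolean p f : Prop := forall e, is_boolean e -> p e = f e.

Definition unique_polynomial_extension f p : Prop :=
  [/\ polynomial_fun p, extends_boolean p f
    & forall q, polynomial_fun q -> extends_boolean q f -> q =1 p].

Definition diag_section f (t : L) : L := f (nseq_tuple n t).

Definition horizontally_maxitive f : Prop :=
  forall x c, f x = f (capc x c) `|` f (cutbot x c).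

Definition horizontally_minitive f : Prop :=
  forall x c, f x = f (cupc x c) `&` f (cuttop x c).

Definition P1 f : Prop := forall e e' c,
  is_boolean e -> is_boolean e' -> e <= e' -> f (capc e c) <= f (capc e' c).

Definition D1 f : Prop := forall e e' c,
  is_boolean e -> is_boolean e' -> e <= e' -> f (cupc e c) <= f (cupc e' c).

Definition comonotonic x x' : Prop :=
  exists s : 'S_n, sorted <=%O [tuple tnth x (s i) | i < n]
                /\ sorted <=%O [tuple tnth x' (s i) | i < n].

Definition comonotonic_maxitive f : Prop :=
  forall x x', comonotonic x x' -> f (x `|` x') = f x `|` f x'.

Definition comonotonic_minitive f : Prop :=
  forall x x', comonotonic x x' -> f (x `&` x') = f x `&` f x'.

Definition factorization f p (phi : L -> L) : Prop :=
  [/\ polynomial_fun p, {homo phi : s t / s <= t}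
    & forall x, f x = p (map_tuple phi x)].

End Definitions.

(* Main.v *)
(** Everything rests on the cuts [cut x t], the boolean tuples indicating
    [t <= x_i].  A polynomial function [p] satisfies [t <= p x] iff
    [t <= p (cut x t)], so it is determined by its values on boolean tuples,
    and, since the cuts of two comonotonic tuples are comparable, it is
    comonotonic maxitive and minitive.  Conversely, peeling off the smallest
    nonzero value of [x] repeatedly, horizontal maxitivity gives
    [f x = f (cut x c /\ c)] for some [c], which horizontal minitivity turns
    into [f (cut x c) /\ delta c].  Dually, [f x = f e \/ delta c] for some [c],
    where [e] indicates [c < x_i].  These two expressions squeeze [f x] to
    [p (delta x)] as soon as [f] is monotone on boolean tuples. *)

Require Import Defs.
From mathcomp Require Import all_boot all_order fingroup perm.

Set Implicit Arguments.
Unset Strict Implicit.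
Unset Printing Implicit Defensive.

Import Order.TTheory.

Local Open Scope order_scope.

(** * Comonotonic tuples as nondecreasing images of one tuple *)

Section Comonotonicity.

Context {d : Order.disp_t} {L : tbOrderType d} {n : nat}.
Implicit Types (x y e : n.-tuple L).

Lemma le_tupleP x y : reflect (forall i, tnth x i <= tnth y i) (x <= y).
Proof. by rewrite leEtprod; apply: forallP. Qed.

(** A permutation sorting [y] sorts every nondecreasing image of [y]. *)
Lemma comonotonic_map d' (T : orderType d') (y : n.-tuple T) (g h : T -> L) :
  {homo g : s t / s <= t} -> {homo h : s t / s <= t} ->
  comonotonic (map_tuple g y) (map_tuple h y).
Proof.
move=> gP hP; have yP : perm_eq (sort <=%O y) y by rewrite perm_sort.
have [s sE] := tuple_permP yP.
have key (k : T -> L) : {homo k : s t / s <= t} ->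
    sorted <=%O [tuple tnth (map_tuple k y) (s i) | i < n].
  move=> kP; suff -> : [tuple tnth (map_tuple k y) (s i) | i < n] =
      map k (sort <=%O y) :> seq L.
    by apply: homo_sorted kP _ _; apply: sort_le_sorted.
  rewrite sE /= -map_comp; apply: eq_map => i.
  by rewrite tnth_map.
by exists s; split; apply: key.
Qed.

(** Trades the permutation for a pairwise condition: [i] and [j] are compared through their ranks
    under [s^-1]. *)
Lemma comonotonic_total x y i j : comonotonic x y ->
  (tnth x i <= tnth x j) && (tnth y i <= tnth y j) ||
  (tnth x j <= tnth x i) && (tnth y j <= tnth y i).
Proof.
move=> [s [xs ys]].
have key (z : n.-tuple L) (k l : 'I_n) :
    sorted <=%O [tuple tnth z (s i) | i < n] -> (k <= l)%N ->
    tnth z (s k) <= tnth z (s l).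
  move=> zs kl; have := le_sorted_leq_nth \bot zs.
  move=> /(_ k l); rewrite !inE !size_tuple !ltn_ord => /(_ isT isT kl).
  by rewrite -!tnth_nth !tnth_mktuple.
rewrite -[i](permKV s) -[j](permKV s).
have [kl|/ltnW kl] := leqP ((s^-1)%g i) ((s^-1)%g j).
  by rewrite (key x) // (key y).
by apply/orP; right; rewrite (key x) // (key y).
Qed.

Lemma comonotonic_map_total (phi : L -> L) x y i j :
  {homo phi : s t / s <= t} -> comonotonic x y ->
  (tnth (map_tuple phi x) i <= tnth (map_tuple phi x) j) &&
  (tnth (map_tuple phi y) i <= tnth (map_tuple phi y) j) ||
  (tnth (map_tuple phi x) j <= tnth (map_tuple phi x) i) &&
  (tnth (map_tuple phi y) j <= tnth (map_tuple phi y) i).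
Proof.
move=> phiP /(comonotonic_total i j); rewrite !tnth_map.
by case/orP=> /andP[/phiP-> /phiP->]; rewrite ?orbT.
Qed.

Lemma is_booleanP e : reflect
  (forall i, tnth e i = \bot \/ tnth e i = \top) (is_boolean e).
Proof.
apply: (iffP all_tnthP) => eP i; have := eP i.
  by case/orP=> /eqP; [left | right].
by case=> /= ->; rewrite eqxx ?orbT.
Qed.

Lemma comonotonic_boolean e e' (g : L -> L) :
  is_boolean e -> is_boolean e' -> e <= e' -> {homo g : s t / s <= t} ->
  comonotonic (map_tuple g e) (map_tuple g e').
Proof.
move=> /is_booleanP eP /is_booleanP eP' /le_tupleP le_ee' gP.
(* Since [e <= e'], an entry of [e] is [\top] iff the count is 2, and an entry of [e'] is [\top] iff
   it is at least 1, so both tuples are images of [y]. *)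
pose y := [tuple ((tnth e i == \top) + (tnth e' i == \top))%N | i < n].
pose above (k m : nat) : L := g (if (k <= m)%N then \top else \bot).
have aboveP k : {homo above k : s t / s <= t}.
  move=> s t; rewrite leEnat => st; apply: gP.
  by case: (leqP k s) => // ks; rewrite (leq_trans ks).
have -> : map_tuple g e = map_tuple (above 2%N) y.
  apply: eq_from_tnth => i; rewrite !tnth_map tnth_ord_tuple /above.
  case: eqP => [E|E].
    by have := le_ee' i; rewrite E le1x => ->.
  by case: (eP i) => // ->; case: eqP.
have -> : map_tuple g e' = map_tuple (above 1%N) y.
  apply: eq_from_tnth => i; rewrite !tnth_map tnth_ord_tuple /above.
  case: eqP => [E|E]; first by have := le_ee' i; rewrite E le1x => /eqP ->.
  by case: eqP => [->|] //; case: (eP' i) => ->.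
exact: comonotonic_map.
Qed.

End Comonotonicity.

(** * Polynomial functions through their cuts *)

Section Cuts.

Context {d : Order.disp_t} {L : tbOrderType d} {n : nat}.
Implicit Types (f p q : n.-tuple L -> L) (x y e : n.-tuple L) (c t : L).

Definition cut x t : n.-tuple L :=
  map_tuple (fun s => if t <= s then \top else \bot) x.

Definition boolean_monotone f : Prop := forall e e',
  is_boolean e -> is_boolean e' -> e <= e' -> f e <= f e'.

Lemma is_boolean_cut x t : is_boolean (cut x t).
Proof. by apply/is_booleanP => i; rewrite tnth_map; case: ifP; auto. Qed.

Lemma le_cut x y t t' : (forall i, t <= tnth x i -> t' <= tnth y i) ->
  cut x t <= cut y t'.
Proof.
move=> xy; apply/le_tupleP => i; rewrite !tnth_map.
by case: ifP => [/xy ->|]; rewrite ?lexx ?le0x.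
Qed.

Lemma eq_cut x y t : (forall i, (t <= tnth x i) = (t <= tnth y i)) ->
  cut x t = cut y t.
Proof.
by move=> xy; apply: le_anti; apply/andP; split; apply: le_cut => i; rewrite xy.
Qed.

(** In a chain, [t] lies below a join iff it lies below one of the two terms, so thresholds pass
    through both operations. *)
Lemma poly_cut p x t : polynomial_fun p -> (t <= p x) = (t <= p (cut x t)).
Proof.
elim=> [i|c|q r _ IHq _ IHr|q r _ IHq _ IHr] //.
- rewrite tnth_map; case: ifP => [_|tx]; first by rewrite lex1.
  by apply/esym; apply: contraFF tx; rewrite lex0 => /eqP ->; apply: le0x.
- by rewrite !lexU IHq IHr.
- by rewrite !lexI IHq IHr.
Qed.

Lemma eq_threshold (a b : L) : (forall t, (t <= a) = (t <= b)) -> a = b.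
Proof. by move=> ab; apply: le_anti; rewrite -ab lexx ab lexx. Qed.

Lemma poly_homo p x y : polynomial_fun p -> x <= y -> p x <= p y.
Proof.
move=> pP /le_tupleP xy; elim: pP => //= q r _ IHq _ IHr; first exact: leU2.
exact: leI2.
Qed.

Lemma poly_unique p q : polynomial_fun p -> polynomial_fun q ->
  (forall e, is_boolean e -> p e = q e) -> p =1 q.
Proof.
move=> pP qP pq x; apply: eq_threshold => t.
by rewrite !(poly_cut x t) // pq ?is_boolean_cut.
Qed.

Lemma poly_comonotonic p x y : polynomial_fun p ->
  (forall i j, (tnth x i <= tnth x j) && (tnth y i <= tnth y j) ||
               (tnth x j <= tnth x i) && (tnth y j <= tnth y i)) ->
  p (x `&` y) = p x `&` p y /\ p (x `|` y) = p x `|` p y.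
Proof.
move=> pP; pose split_at (x y : n.-tuple L) t :=
  (t <= p (x `&` y)) = (t <= p x `&` p y) /\
  (t <= p (x `|` y)) = (t <= p x `|` p y).
(* At each level [t] the two cuts are nested; by symmetry the first may be taken as the smaller one.
   It is then the cut of the meet, and the other is the cut of the join. *)
suff sub_split x' y' t : (forall i, t <= tnth x' i -> t <= tnth y' i) ->
    split_at x' y' t.
  move=> xyP; suff key t : split_at x y t.
    by split; apply: eq_threshold => t; have [] := key t.
  have [/forallP xy|] := boolP [forall i, (t <= tnth x i) ==> (t <= tnth y i)].
    by apply: sub_split => i; apply/implyP.
  (* An index in the cut of [x] but not in that of [y] forces, by the pairwise condition, the
     reverse inclusion. *)
  rewrite negb_forall => /existsP[i]; rewrite negb_imply -ltNge => /andP[xi yi].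
  rewrite /split_at meetC [p x `&` _]meetC joinC [p x `|` _]joinC.
  apply: sub_split => j yj; case/orP: (xyP i j) => /andP[xij yij].
    exact: le_trans xij.
  by have := lt_le_trans yi (le_trans yj yij); rewrite ltxx.
move=> xy; have pxy : t <= p x' -> t <= p y'.
  rewrite (poly_cut x' t pP) (poly_cut y' t pP) => /le_trans; apply.
  exact: poly_homo pP (le_cut xy).
rewrite /split_at lexI lexU (poly_cut (_ `&` _) t pP) (poly_cut (_ `|` _) t pP).
have -> : cut (x' `&` y') t = cut x' t.
  apply: eq_cut => i; rewrite tnth_meet lexI; apply: andb_idr; exact: xy.
have -> : cut (x' `|` y') t = cut y' t.
  apply: eq_cut => i; rewrite tnth_join lexU; apply: orb_idl; exact: xy.
rewrite -(poly_cut x' t pP) -(poly_cut y' t pP); split; apply/esym.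
  exact: andb_idr.
exact: orb_idl.
Qed.

Lemma poly_bigjoin (I : Type) (r : seq I) (F : I -> n.-tuple L -> L) :
  (forall i, exists2 p, polynomial_fun p & p =1 F i) ->
  exists2 p, polynomial_fun p & forall x, p x = \join_(i <- r) F i x.
Proof.
move=> FP; elim: r => [|i r [p pP pE]].
  by exists (fun=> \bot) => [|x]; [exact: Poly_const | rewrite big_nil].
have [q qP qE] := FP i.
exists (fun x => q x `|` p x) => [|x]; first exact: Poly_join.
by rewrite big_cons qE pE.
Qed.

Lemma poly_bigmeet (r : seq 'I_n) (P : pred 'I_n) :
  exists2 p, polynomial_fun p & forall x, p x = \meet_(i <- r | P i) tnth x i.
Proof.
elim: r => [|i r [p pP pE]].
  by exists (fun=> \top) => [|x]; [exact: Poly_const | rewrite big_nil].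
case Pi: (P i); last by exists p => // x; rewrite big_cons Pi.
exists (fun x => tnth x i `&` p x) => [|x]; last by rewrite big_cons Pi pE.
by apply: Poly_meet => //; apply: Poly_proj.
Qed.

Lemma poly_extension_exists f : boolean_monotone f ->
  exists p, unique_polynomial_extension f p.
Proof.
move=> fP; pose chi (A : {set 'I_n}) : n.-tuple L :=
  [tuple if i \in A then \top else \bot | i < n].
have chiP A : is_boolean (chi A).
  by apply/is_booleanP => i; rewrite tnth_mktuple; case: ifP; auto.
(* The extension is the disjunctive normal form, the join of these terms over all subsets [A]. *)
pose F (A : {set 'I_n}) x := f (chi A) `&` \meet_(i in A) tnth x i.
have [A|p pP pE] := @poly_bigjoin _ (index_enum {set 'I_n}) F.
  have [q qP qE] := poly_bigmeet (index_enum 'I_n) (mem A).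
  exists (fun x => f (chi A) `&` q x) => [|x]; last by rewrite qE.
  by apply: Poly_meet => //; apply: Poly_const.
have pf : extends_boolean p f.
  move=> e eP; have /is_booleanP eB := eP; rewrite pE.
  apply: le_anti; apply/andP; split.
    apply/joinsP => A _; rewrite /F.
    (* If [A] lies in the support of [e], monotonicity bounds the term by [f e]; otherwise some
       factor is [\bot]. *)
    have [sAe|] := boolP [forall i in A, tnth e i == \top].
      apply: leIxl; apply: fP => //; apply/le_tupleP => i; rewrite tnth_mktuple.
      by case: ifP => [iA|_]; rewrite ?le0x // (eqP (forall_inP sAe i iA)).
    rewrite negb_forall => /existsP[i]; rewrite negb_imply => /andP[iA ei].
    apply: leIxr; rewrite (bigD1 i) //=; case: (eB i) => E.
      by rewrite E meet0x le0x.
    by rewrite E eqxx in ei.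
  (* The support of [e] contributes a term that is at least [f e]. *)
  pose A := [set i | tnth e i == \top].
  have eE : chi A = e.
    apply: eq_from_tnth => i; rewrite tnth_mktuple inE.
    by case: eqP => [->//|E]; case: (eB i).
  have FA : f e <= F A e.
    by rewrite /F eE lexI lexx; apply/meetsP => i; rewrite inE => /eqP ->.
  by apply: le_trans FA (joins_sup_seq (F^~ e) _ _); rewrite ?mem_index_enum.
exists p; split=> // q qP qf; apply: poly_unique => // e eP.
by rewrite qf // pf.
Qed.

End Cuts.

(** * Consequences of horizontal maxitivity and minitivity *)

Section Horizontal.

Context {d : Order.disp_t} {L : tbOrderType d} {n : nat}.
Implicit Types (f : n.-tuple L -> L) (x e : n.-tuple L) (c : L).

Lemma hmax_cut f x : horizontally_maxitive f ->
  exists c, f x = f (capc (cut x c) c).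
Proof.
(* Locating [c] among the entries makes the induction work: a nonzero level found for [cutbot x c]
   must then exceed [c]. *)
move=> fP; suff [c _ E] : exists2 c, c \in \bot :: x & f x = f (capc (cut x c) c).
  by exists c.
have [m] := ubnP #|[set i | tnth x i != \bot]|.
elim: m x => // m IHm x; rewrite ltnS => xm.
have [i0 i0P|x0] := pickP (fun i => tnth x i != \bot); last first.
  exists \bot; first by rewrite inE eqxx.
  congr f; apply: eq_from_tnth => i; rewrite !tnth_map le0x meetx0.
  by apply/eqP; have := x0 i; case: eqP.
case: (@Order.TotalTheory.arg_minP _ _ _ i0 (fun i => tnth x i != \bot)
         (tnth x) i0P) => j xj jP.
pose c := tnth x j; have cx : c \in \bot :: x by rewrite inE mem_tnth orbT.
have capE : capc x c = capc (cut x c) c.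
  apply: eq_from_tnth => i; rewrite !tnth_map; case: ifP => [ci|ci].
    by rewrite meet1x; apply/meet_idPr.
  have /eqP -> : tnth x i == \bot by apply: contraFT ci; apply: jP.
  by [].
have fE := fP x c.
(* In a chain a join equals one of its terms: either [c] is the level sought, or the search
   continues in [cutbot x c], which has fewer nonzero entries. *)
have [fx|fx] : f x = f (capc x c) \/ f x = f (cutbot x c).
  by rewrite fE; case: leP; auto.
  by exists c; rewrite // fx capE.
have [|c' c'x f'E] := IHm (cutbot x c).
  apply: leq_trans xm; apply: proper_card; apply/properP; split.
    apply/subsetP => i; rewrite !inE tnth_map.
    by case: ifP => //; rewrite eqxx.
  by exists j; rewrite inE // tnth_map lexx eqxx.
have [c'0|c'0] := eqVneq c' \bot.
  exists \bot; first by rewrite inE eqxx.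
  rewrite fx f'E c'0; congr f; apply: eq_from_tnth => i.
  by rewrite !tnth_map !meetx0.
move: c'x; rewrite inE (negPf c'0) /= => /tnthP[k]; rewrite tnth_map.
case: ifP => [_ E|ck c'E]; first by rewrite E eqxx in c'0.
exists c'; first by rewrite inE c'E mem_tnth orbT.
(* As [c < c'], the entries erased from [x] were below level [c'] anyway, so both cuts agree. *)
rewrite fx f'E; congr (f (capc _ _)); apply: eq_from_tnth => i.
rewrite !tnth_map; case: (leP (tnth x i) c) => // ic.
by rewrite lex0 (negPf c'0) c'E leNgt (le_lt_trans ic) // ltNge ck.
Qed.

Lemma hmax_bot f x : horizontally_maxitive f -> f (nseq_tuple n \bot) <= f x.
Proof.
move=> /(_ x \top) ->; apply: lexUr; suff -> : cutbot x \top = nseq_tuple n \bot by [].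
by apply: eq_from_tnth => i; rewrite tnth_map tnth_nseq lex1.
Qed.

Lemma hmax_diag f : horizontally_maxitive f ->
  {homo diag_section f : s t / s <= t}.
Proof.
move=> fP s t st; rewrite /diag_section (fP (nseq_tuple n t) s); apply: lexUl.
suff -> : capc (nseq_tuple n t) s = nseq_tuple n s by [].
by apply: eq_from_tnth => i; rewrite tnth_map !tnth_nseq; apply/meet_idPr.
Qed.

(** Minitivity at level [c]: [cuttop] turns [capc e c] back into [e], and [cupc] flattens it to the
    constant [c]. For [c = \bot], [cuttop] would raise every entry to [\top], so [hmax_bot] is used
    instead. *)
Lemma hmin_boolean f e c : horizontally_maxitive f -> horizontally_minitive f ->
  is_boolean e -> f (capc e c) = f e `&` diag_section f c.
Proof.
move=> fmax fmin /is_booleanP eP; have [->|c0] := eqVneq c \bot.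
  have -> : capc e \bot = nseq_tuple n \bot.
    by apply: eq_from_tnth => i; rewrite tnth_map tnth_nseq meetx0.
  by apply/esym/meet_idPr; apply: hmax_bot.
rewrite (fmin (capc e c) c) meetC; congr (f _ `&` f _).
  apply: eq_from_tnth => i; rewrite !tnth_map; case: (eP i) => ->.
    by rewrite meet0x lex0 (negPf c0).
  by rewrite meet1x lexx.
apply: eq_from_tnth => i; rewrite !tnth_map tnth_nseq.
exact/join_idPr/leIr.
Qed.

End Horizontal.

(** * Factorization and the links between the properties *)

Section Main.

Context {d : Order.disp_t} {L : tbOrderType d} {n : nat}.
Implicit Types (f p : n.-tuple L -> L) (x e : n.-tuple L) (c : L).

(** [hmax_cut] read in the dual chain, where meet and join, [\bot] and [\top] trade places. *)
Lemma hmin_cut f x : horizontally_minitive f -> exists c,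
  f x = f (cupc (map_tuple (fun t => if t <= c then \bot else \top) x) c).
Proof. exact: (@hmax_cut _ (L^d)%O). Qed.

Lemma hmax_boolean f e c : horizontally_maxitive f -> horizontally_minitive f ->
  is_boolean e -> f (cupc e c) = f e `|` diag_section f c.
Proof.
move=> fmax fmin eP; apply: (@hmin_boolean _ (L^d)%O) => //.
by apply/is_booleanP => i; case: (is_booleanP _ eP i) => ->; [right | left].
Qed.

Lemma horizontal_factorization f p :
  horizontally_maxitive f -> horizontally_minitive f -> boolean_monotone f ->
  polynomial_fun p -> extends_boolean p f ->
  factorization f p (diag_section f).
Proof.
move=> fmax fmin fmon pP pf; have dP := hmax_diag fmax.
split=> // x; set y := map_tuple _ x.
have pE t : (t <= p y) = (t <= f (cut y t)).
  by rewrite (poly_cut y t pP) pf ?is_boolean_cut.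
apply: le_anti; apply/andP; split.
  have [c] := hmax_cut x fmax.
  rewrite hmin_boolean ?is_boolean_cut // => fx.
  have /andP[fc dc] : (f x <= f (cut x c)) && (f x <= diag_section f c).
    by rewrite -lexI -fx.
  (* Since [f x <= diag_section f c], each [i] with [c <= x_i] satisfies [f x <= y_i]: the cut of
     [x] at [c] lies below that of [y] at [f x]. *)
  rewrite pE; apply: le_trans fc _; apply: fmon; rewrite ?is_boolean_cut //.
  by apply: le_cut => i ci; rewrite tnth_map (le_trans dc) ?dP.
have [c] := hmin_cut x fmin; set e := map_tuple _ x.
have eP : is_boolean e.
  by apply/is_booleanP => i; rewrite tnth_map; case: ifP; auto.
rewrite hmax_boolean // => ->.
rewrite lexU; have [//|dc] := leP (p y) (diag_section f c); first by rewrite orbT.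
(* Now [diag_section f c < p y], so [p y <= y_i] excludes [x_i <= c]: the cut of [y] at [p y] lies
   below [e]. *)
rewrite orbF; have := lexx (p y); rewrite pE => /le_trans; apply.
apply: fmon; rewrite ?is_boolean_cut //; apply/le_tupleP => i; rewrite !tnth_map.
case: ifP => [pd|_]; last exact: le0x.
case: ifP => // xc; have := lt_le_trans dc (le_trans pd (dP _ _ xc)).
by rewrite ltxx.
Qed.

(** On a chain, a nondecreasing [phi] commutes with min and max and keeps the pairwise condition. *)
Lemma factorization_comonotonic f p (phi : L -> L) : factorization f p phi ->
  comonotonic_maxitive f /\ comonotonic_minitive f.
Proof.
move=> [pP phiP fE]; split=> x y xy; rewrite !fE;
  have [pI pU] := poly_comonotonic pP (fun i j => comonotonic_map_total i j phiP xy).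
  rewrite -pU; congr p; apply: eq_from_tnth => i.
  rewrite tnth_map !tnth_join !tnth_map.
  by case: (leP (tnth x i) (tnth y i)) => [|/ltW] /phiP h; apply/esym;
    [apply/join_idPr | apply/join_idPl].
rewrite -pI; congr p; apply: eq_from_tnth => i.
rewrite tnth_map !tnth_meet !tnth_map.
by case: (leP (tnth x i) (tnth y i)) => [|/ltW] /phiP h; apply/esym;
  [apply/meet_idPl | apply/meet_idPr].
Qed.

(** [capc x c] and [cutbot x c] are nondecreasing images of [x] with join [x]. *)
Lemma comonotonic_hmax f : comonotonic_maxitive f -> horizontally_maxitive f.
Proof.
move=> fP x c; rewrite -fP.
  congr f; apply: eq_from_tnth => i; rewrite tnth_join !tnth_map.
  case: leP => [xc|/ltW cx]; first by rewrite joinx0.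
  exact/esym/join_idPr.
apply: comonotonic_map => s t st; first exact: leI2.
case: ifP => [_|cs]; first exact: le0x.
by case: ifP => // tc; rewrite (le_trans st tc) in cs.
Qed.

Lemma comonotonic_hmin f : comonotonic_minitive f -> horizontally_minitive f.
Proof.
move=> fP x c; rewrite -fP.
  congr f; apply: eq_from_tnth => i; rewrite tnth_meet !tnth_map.
  case: leP => [cx|/ltW xc]; first by rewrite meetx1.
  exact/esym/meet_idPr.
apply: comonotonic_map => s t st; first exact: leU2.
case: ifP => [cs|_]; first by rewrite (le_trans cs st) lexx.
by case: ifP => // _; apply: lex1.
Qed.

(** The two capped tuples are comonotonic and their meet is the smaller one. *)
Lemma comonotonic_minitive_P1 f : comonotonic_minitive f -> P1 f.
Proof.
move=> fP e e' c eP eP' le_ee'.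
have gP : {homo (fun t : L => t `&` c) : s t / s <= t}.
  by move=> s t st; apply: leI2.
have -> : capc e c = capc e c `&` capc e' c.
  by apply/esym/meet_idPl/le_tupleP => i; rewrite !tnth_map gP //; apply/le_tupleP.
by rewrite (fP _ _ (comonotonic_boolean eP eP' le_ee' gP)) leIr.
Qed.

Lemma comonotonic_maxitive_boolean_monotone f :
  comonotonic_maxitive f -> boolean_monotone f.
Proof.
move=> fP e e' eP eP' le_ee'.
have mapid x : map_tuple id x = x by apply: eq_from_tnth => i; rewrite tnth_map.
have := @comonotonic_boolean _ _ _ e e' id eP eP' le_ee' (fun _ _ => id).
by rewrite !mapid => /fP; rewrite (join_idPr le_ee') => ->; apply: leUl.
Qed.

Lemma P1_boolean_monotone f : P1 f -> boolean_monotone f.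
Proof.
have capc1 x : capc x \top = x.
  by apply: eq_from_tnth => i; rewrite tnth_map meetx1.
by move=> fP e e' eP eP' /(fP e e' \top eP eP'); rewrite !capc1.
Qed.

Lemma D1_boolean_monotone f : D1 f -> boolean_monotone f.
Proof.
have cupc0 x : cupc x \bot = x.
  by apply: eq_from_tnth => i; rewrite tnth_map joinx0.
by move=> fP e e' eP eP' /(fP e e' \bot eP eP'); rewrite !cupc0.
Qed.

End Main.

(** * The cycle of implications and the canonical factorization *)

Theorem theorem11 (d : Order.disp_t) (L : tbOrderType d) (n : nat)
    (n_gt0 : (0 < n)%N) (f : n.-tuple L -> L) :
  [<-> [/\ horizontally_maxitive f, horizontally_minitive f & P1 f \/ D1 f];
       comonotonic_maxitive f /\ comonotonic_minitive f;
       horizontally_maxitive f /\ comonotonic_minitive f;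
       comonotonic_maxitive f /\ horizontally_minitive f;
       exists (p : n.-tuple L -> L) (phi : L -> L), factorization f p phi]
  /\ ((exists (p : n.-tuple L -> L) (phi : L -> L), factorization f p phi) ->
      exists p_f : n.-tuple L -> L,
        unique_polynomial_extension f p_f /\
        factorization f p_f (diag_section f)).
Proof.
have canonical : horizontally_maxitive f -> horizontally_minitive f ->
    boolean_monotone f -> exists p_f : n.-tuple L -> L,
      unique_polynomial_extension f p_f /\
      factorization f p_f (diag_section f).
  move=> fmax fmin fmon; have [p pE] := poly_extension_exists fmon.
  by exists p; split=> //; case: pE => pP pf _; apply: horizontal_factorization.
have factor : horizontally_maxitive f -> horizontally_minitive f ->
    boolean_monotone f ->
    exists (p : n.-tuple L -> L) (phi : L -> L), factorization f p phi.
  move=> fmax fmin /(canonical fmax fmin)[p [_ pE]].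
  by exists p, (diag_section f).
have comonotone : (exists (p : n.-tuple L -> L) (phi : L -> L),
    factorization f p phi) -> comonotonic_maxitive f /\ comonotonic_minitive f.
  by case=> p [phi /factorization_comonotonic].
split; last first.
  move=> /comonotone[fmax fmin]; apply: canonical.
  - exact: comonotonic_hmax.
  - exact: comonotonic_hmin.
  - exact: comonotonic_maxitive_boolean_monotone.
tfae.
- case=> fmax fmin fmon; apply/comonotone/factor => //.
  by case: fmon => [/P1_boolean_monotone|/D1_boolean_monotone].
- by case=> /comonotonic_hmax.
- case=> fmax fmin.
  (* Comonotonic maxitivity is recovered by passing through the factorization. *)
  have fmon := P1_boolean_monotone (comonotonic_minitive_P1 fmin).
  have fhmin := comonotonic_hmin fmin.
  by have [] := comonotone (factor fmax fhmin fmon).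
- case=> fmax fmin; apply: factor => //; first exact: comonotonic_hmax.
  exact: comonotonic_maxitive_boolean_monotone.
- move=> /comonotone[fmax fmin]; split.
  + exact: comonotonic_hmax.
  + exact: comonotonic_hmin.
  + by left; apply: comonotonic_minitive_P1.
Qed.
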